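(* Let $p$ be a prime. Then the families $\mathcal{G}_p$ and $\mathcal{S}_p$ are equal, i.e. a finite $p$-group belongs to $\mathcal{G}_p$ if and only if it is semiabelian.
   Context: All groups are finite. For a finite group $G$, $d(G)$ denotes the minimal number of generators of $G$. An epimorphism $G\to\Gamma$ is rank preserving if $d(G)=d(\Gamma)$. For finite groups $H,G$, the standard (regular) wreath product $H\wr G$ is the semidirect product $H^G\rtimes G$, where $H^G$ is the group of all functions $f:G\to H$ (pointwise multiplication) and $G$ acts by $f^g(x)=f(xg^{-1})$ for $x,g\in G$. $\mathcal{G}_p$ is the minimal family of groups satisfying: (1) any abelian $p$-group is in $\mathcal{G}_p$; (2) if $H,G\in\mathcal{G}_p$ then the standard wreath product $H\wr G$ is in $\mathcal{G}_p$; (3) if $G\in\mathcal{G}_p$ and $G\to\Gamma$ is a rank preserving epimorphism then $\Gamma\in\mathcal{G}_p$. The family $\mathcal{S}$ of semiabelian groups is the minimal family of groups satisfying: (1) $\{1\}\in\mathcal{S}$; (2) if $A$ is a finite abelian group and $H\in\mathcal{S}$ acts on $A$ (by automorphisms) then the semidirect product $A\rtimes H$ is in $\mathcal{S}$; (3) if $G\in\mathcal{S}$ and $G\to\Gamma$ is an epimorphism then $\Gamma\in\mathcal{S}$. $\mathcal{S}_p$ denotes the family of semiabelian $p$-groups, i.e. the $p$-groups that lie in $\mathcal{S}$. *)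

(* Defs.v *)
From HB Require Import structures.
From mathcomp Require Import all_boot all_fingroup all_solvable.

Set Implicit Arguments.
Unset Strict Implicit.
Unset Printing Implicit Defensive.

Import GroupScope.

(* A finite group is a finGroupType, taken as the whole set [set: gT].        *)

Definition epimorphism (G Gamma : finGroupType)
    (f : {morphism [set: G] >-> Gamma}) : Prop :=
  f @* [set: G] = [set: Gamma].

Definition rank_preserving (G Gamma : finGroupType)
    (f : {morphism [set: G] >-> Gamma}) : Prop :=
  'm([set: G]) = 'm([set: Gamma]).

Section WreathAction.

Variables H G : finGroupType.

(* The base group H ^ G: dffun (rather than ffun) is the type that carries    *)
(* the pointwise group structure.                                             *)
Definition wr_base : finGroupType := {dffun forall _ : G, H}.

Definition wr_act (f : wr_base) (g : G) : wr_base :=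
  [ffun x => f (x * g^-1)].

Lemma wr_act1 : wr_act^~ 1 =1 id.
Proof. by move=> f; apply/ffunP => x; rewrite ffunE invg1 mulg1. Qed.

Lemma wr_actM f : act_morph wr_act f.
Proof. by move=> a b; apply/ffunP => x; rewrite !ffunE invMg mulgA. Qed.

Definition wr_action : {action G &-> wr_base} := TotalAction wr_act1 wr_actM.

Lemma wr_is_groupAction : is_groupAction [set: wr_base] wr_action.
Proof.
move=> a _; rewrite inE; apply/andP; split.
  by apply/subsetP => x _; rewrite inE.
apply/morphicP => u v _ _; rewrite !actpermE /=.
by apply/ffunP => x; rewrite !ffunE.
Qed.

Definition wr_groupAction : groupAction [set: G] [set: wr_base] :=
  GroupAction wr_is_groupAction.

End WreathAction.

(* sdprod_by is built on pairs (g, f) standing for the product g f, with      *)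
(* (g, f) (g', f') = (g g', f ^ g' f').                                       *)
Definition wreath (H G : finGroupType) : finGroupType :=
  sdprod_by (wr_groupAction H G).

Inductive in_G (p : nat) : finGroupType -> Prop :=
| in_G_abelian (A : finGroupType) :
    abelian [set: A] -> p.-group [set: A] -> in_G p A
| in_G_wreath (H G : finGroupType) :
    in_G p H -> in_G p G -> in_G p (wreath H G)
| in_G_quotient (G Gamma : finGroupType) (f : {morphism [set: G] >-> Gamma}) :
    in_G p G -> epimorphism f -> rank_preserving f -> in_G p Gamma.

Inductive semiabelian : finGroupType -> Prop :=
| semiabelian_trivial (T : finGroupType) :
    [set: T] = [1 T] -> semiabelian T
| semiabelian_sdprod (A H : finGroupType)
    (to : groupAction [set: H] [set: A]) :
    abelian [set: A] -> semiabelian H -> semiabelian (sdprod_by to)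
| semiabelian_quotient (G Gamma : finGroupType)
    (f : {morphism [set: G] >-> Gamma}) :
    semiabelian G -> epimorphism f -> semiabelian Gamma.

Definition in_S (p : nat) (G : finGroupType) : Prop :=
  p.-group [set: G] /\ semiabelian G.

(* Main.v *)
(* Call x_1, ..., x_n a tower when, for every i, the conjugates of x_i under
   <x_(i+1), ..., x_n> commute pairwise.  A finite group is semiabelian iff it
   is generated by a tower: such a group is a quotient of the iterated wreath
   product <x_1> wr (<x_2> wr (... wr <x_n>)), and conversely towers can be
   assembled along abelian normal subgroups and wreath products.  A subsequence
   of a tower is a tower, so by the Burnside basis theorem a semiabelian p-group
   G is generated by a tower of length d(G).  The iterated wreath product then
   has rank at most d(G), whence its projection onto G is rank preserving. *)
Require Import Defs.
From mathcomp Require Import all_boot all_fingroup all_solvable.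
From mathcomp Require Import ssralg.

Set Implicit Arguments.
Unset Strict Implicit.
Unset Printing Implicit Defensive.

Import GroupScope.
Import FiniteModule.

(** * Sequences as generating sets *)

Lemma set_seq_cat (T : finType) (s t : seq T) :
  [set:: s ++ t] = [set:: s] :|: [set:: t].
Proof. by apply/setP => x; rewrite !inE mem_cat. Qed.

Lemma set_seq_map (T U : finType) (f : T -> U) (s : seq T) :
  [set:: map f s] = f @: [set:: s].
Proof.
apply/setP => y; rewrite inE; apply/mapP/imsetP => -[x xs ->]; exists x => //.
  by rewrite inE.
by rewrite inE in xs.
Qed.

Lemma card_set_seq (T : finType) (s : seq T) : #|[set:: s]| <= size s.
Proof. by rewrite cardsE card_size. Qed.

Lemma morphim_gen_seq (gT rT : finGroupType) (D : {group gT})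
    (f : {morphism D >-> rT}) (s : seq gT) :
  [set:: s] \subset D -> f @* <<[set:: s]>> = <<[set:: map f s]>>.
Proof. by move=> sD; rewrite morphim_gen // set_seq_map morphimEsub. Qed.

Lemma im_gen_seq (gT rT : finGroupType) (f : {morphism [set: gT] >-> rT})
    (s : seq gT) :
  <<[set:: s]>> = [set: gT] -> f @* [set: gT] = <<[set:: map f s]>>.
Proof.
move=> gen_s.
by rewrite -morphim_gen_seq ?subsetT // (congr1 (morphim _) gen_s).
Qed.

(** * Abelian towers *)

Fixpoint abelian_tower (gT : finGroupType) (s : seq gT) : bool :=
  if s is x :: t then abelian (x ^: <<[set:: t]>>) && abelian_tower t else true.

(** Dropping entries shrinks the subgroups that conjugate, hence also the classes required to be
    abelian. *)
Lemma abelian_tower_subseq (gT : finGroupType) (t s : seq gT) :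
  subseq t s -> abelian_tower s -> abelian_tower t.
Proof.
elim: s t => [|x s IHs] [|y t] //= sub_ts /andP[abx tow_s].
case: eqP sub_ts => [->|_] sub_ts; last exact: (IHs (y :: t)).
rewrite IHs // andbT; apply: abelianS abx; apply: imsetS; apply: genS.
by apply/subsetP => z; rewrite !inE; apply: mem_subseq.
Qed.

Lemma abelian_tower_map (gT rT : finGroupType) (D : {group gT})
    (f : {morphism D >-> rT}) (s : seq gT) :
  [set:: s] \subset D -> abelian_tower s -> abelian_tower (map f s).
Proof.
elim: s => //= x s IHs; rewrite set_cons subUset sub1set => /andP[Dx sD].
case/andP => abx tow_s; rewrite IHs // andbT set_seq_map -morphimEsub //.
by rewrite -morphim_gen // -morphim_class ?gen_subG // morphim_abelian.
Qed.

Lemma abelian_class_gen (gT : finGroupType) (C : {group gT}) (S : {set gT}) x :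
  abelian C -> x \in C -> S \subset 'N(C) -> abelian (x ^: <<S>>).
Proof.
move=> abC xC nCS; apply: abelianS abC; apply/subsetP => _ /imsetP[y Sy ->].
by rewrite memJ_norm // (subsetP _ y Sy) // gen_subG.
Qed.

(** All conjugates of an entry of [s] by later entries stay in [C], which is abelian. *)
Lemma abelian_tower_cat (gT : finGroupType) (C : {group gT}) (s t : seq gT) :
    abelian C -> [set:: s] \subset C -> [set:: t] \subset 'N(C) ->
  abelian_tower t -> abelian_tower (s ++ t).
Proof.
move=> abC sC nCt tow_t; elim: s sC => //= x s IHs.
rewrite set_cons subUset sub1set => /andP[Cx sC]; rewrite IHs // andbT.
rewrite (abelian_class_gen abC) // set_seq_cat subUset nCt andbT.
exact: subset_trans sC (normG C).
Qed.

(** * Groups generated by a tower *)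

Definition tower_generated (gT : finGroupType) : Prop :=
  exists2 s : seq gT, abelian_tower s & <<[set:: s]>> = [set: gT].

Lemma gen_enum (gT : finGroupType) : <<[set:: enum gT]>> = [set: gT].
Proof.
apply/eqP; rewrite -subTset sub_gen //.
by apply/subsetP => x _; rewrite inE mem_enum.
Qed.

Lemma abelian_tower_generated (gT : finGroupType) :
  abelian [set: gT] -> tower_generated gT.
Proof.
move=> abT; exists (enum gT); last exact: gen_enum.
rewrite -[enum _]cats0.
by apply: (abelian_tower_cat (C := [set: gT]));
  rewrite ?subsetT ?set_nil ?sub0set.
Qed.

Lemma quotient_tower_generated (gT rT : finGroupType)
    (f : {morphism [set: gT] >-> rT}) :
  epimorphism f -> tower_generated gT -> tower_generated rT.
Proof.
move=> epi_f [s tow_s gen_s]; exists (map f s).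
  by rewrite abelian_tower_map ?subsetT.
by rewrite -im_gen_seq.
Qed.

Lemma sdprod_tower_generated (A H : finGroupType)
    (to : groupAction [set: H] [set: A]) :
  abelian [set: A] -> tower_generated H -> tower_generated (sdprod_by to).
Proof.
move=> abA [s tow_s gen_s].
exists (map (sdpair1 to) (enum A) ++ map (sdpair2 to) s).
  apply: (@abelian_tower_cat _ (sdpair1 to @* [set: A])%G).
  - exact: morphim_abelian.
  - rewrite set_seq_map -morphimEsub ?subsetT //; exact: morphimS (subsetT _).
  - rewrite set_seq_map -morphimEsub ?subsetT //.
    exact: subset_trans (morphimS _ (subsetT _)) (im_sdpair_norm to).
  by rewrite abelian_tower_map ?subsetT.
rewrite set_seq_cat -joingE -joing_idl -joing_idr.
rewrite -(im_gen_seq _ gen_s) -im_gen_seq; last exact: gen_enum.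
by rewrite norm_joinEr ?im_sdpair_norm //= im_sdpair.
Qed.

(** * Generators and towers of wreath products *)

Section Wreath.

Variables H G : finGroupType.

Local Notation bot := (sdpair1 (wr_groupAction H G)).
Local Notation top := (sdpair2 (wr_groupAction H G)).

(* dfung1 lands in {dffun forall _ : G, H}, which canonical structure inference
   does not identify with wr_base H G. *)
Definition wr_delta (g : G) (h : H) : wr_base H G :=
  @dfung1 G (fun=> H) g h.

Lemma wr_delta_morphM g : {in [set: H] &, {morph wr_delta g : x y / x * y}}.
Proof. by move=> x y _ _; apply: dfung1_morphM. Qed.

Canonical wr_delta_morphism g := Morphism (@wr_delta_morphM g).

Lemma wr_delta_act g h : wr_act (wr_delta 1 h) g = wr_delta g h.
Proof.
apply/ffunP => x; rewrite ffunE /wr_delta; have [<-|neq_gx] := eqVneq g x.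
  by rewrite mulgV !dfung1_id.
rewrite !dfung1_dflt //; apply: contra neq_gx => /eqP def_x.
by rewrite -(mulgKV g x) -def_x mul1g.
Qed.

Lemma wr_delta_conj g h : bot (wr_delta 1 h) ^ top g = bot (wr_delta g h).
Proof. by rewrite -sdpair_act ?inE //= wr_delta_act. Qed.

Lemma sub_wr_base (M : {group wr_base H G}) :
  (forall g h, wr_delta g h \in M) -> [set: wr_base H G] \subset M.
Proof.
move=> Mgh.
have ->: [set: wr_base H G] = setXn (fun _ : G => [set: H]).
  by apply/setP => f; rewrite inE; apply/esym/setXnP => i; rewrite inE.
rewrite -setXn_prod; apply: prod_subG => g _; rewrite -morphim_dfung1.
by apply/subsetP => _ /morphimP[h _ _ ->]; apply: Mgh.
Qed.

(** Conjugation by the top group moves the coordinate at 1 to every other one, so this copy of [H]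
    and the top group generate everything. *)
Lemma sub_wreath (M : {group wreath H G}) :
    (forall h, bot (wr_delta 1 h) \in M) -> (forall g, top g \in M) ->
  [set: wreath H G] \subset M.
Proof.
move=> Mh Mg; have topM: top @* [set: G] \subset M.
  by apply/subsetP => _ /morphimP[g _ _ ->]; apply: Mg.
rewrite -[[set: _]](im_sdpair (wr_groupAction H G)) mul_subG //.
rewrite sub_morphim_pre ?subsetT //.
apply: (sub_wr_base (M := (bot @*^-1 M)%G)) => g h.
rewrite mem_morphpre ?inE //; have:= groupJ (Mh h) (Mg g).
by rewrite wr_delta_conj; apply.
Qed.

Definition wr_seq (sH : seq H) (sG : seq G) : seq (wreath H G) :=
  map bot (map (wr_delta 1) sH) ++ map top sG.

Lemma gen_wr_seq sH sG :
    <<[set:: sH]>> = [set: H] -> <<[set:: sG]>> = [set: G] ->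
  <<[set:: wr_seq sH sG]>> = [set: wreath H G].
Proof.
move=> genH genG; apply/eqP; rewrite -subTset set_seq_cat.
apply: sub_wreath => [h|g].
  apply: (subsetP (genS (subsetUl _ _))).
  rewrite -morphim_gen_seq ?subsetT // -im_gen_seq //.
  by rewrite !mem_morphim ?inE.
apply: (subsetP (genS (subsetUr _ _))).
by rewrite -im_gen_seq // mem_morphim ?inE.
Qed.

Lemma abelian_tower_wr_seq sH sG :
  abelian_tower sH -> abelian_tower sG -> abelian_tower (wr_seq sH sG).
Proof.
move=> tow_H tow_G; elim: sH tow_H => [_|h s IHs /= /andP[abh tow_s]].
  by rewrite abelian_tower_map ?subsetT.
rewrite IHs // andbT.
(* [B] is abelian and normalised by [s]. The functions with values in [B] then form an abelian
   subgroup [C] of the base that contains the conjugates of the new entry. *)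
pose B := <<h ^: <<[set:: s]>>>>%G.
have nB : <<[set:: s]>> \subset 'N(B) by rewrite norms_gen // class_norm.
pose C := (bot @* setXn (fun _ : G => B))%G.
(* Applied both to [B] and to its normaliser. *)
have mem_delta (K : {group H}) k : k \in K -> wr_delta 1 k \in setXn (fun=> K).
  move=> Kk; apply/setXnP => i; rewrite /wr_delta.
  by have [<-|ne] := eqVneq 1 i; rewrite ?dfung1_id ?dfung1_dflt.
apply: (@abelian_class_gen _ C).
- rewrite morphim_abelian //; apply/centsP => u /setXnP Bu v /setXnP Bv.
  have abB : abelian B by rewrite abelian_gen.
  by apply/ffunP => i; rewrite !ffunE; apply: (centsP abB).
- apply: mem_morphim; first by rewrite inE.
  by apply: mem_delta; rewrite mem_gen // class_refl.
rewrite set_seq_cat subUset; apply/andP; split; apply/subsetP => z; rewrite inE.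
  case/mapP => _ /mapP[k sk ->] ->.
  have Nk: k \in 'N(B) by rewrite (subsetP nB) // mem_gen // inE.
  rewrite (subsetP (morphim_norm _ _)) //; apply: mem_morphim; rewrite inE //.
  apply/subsetP => _ /imsetP[u /setXnP Bu ->]; apply/setXnP => i.
  have /setXnP/(_ i) Ni := mem_delta 'N(B)%G k Nk.
  have ->: (u ^ wr_delta 1 k) i = u i ^ wr_delta 1 k i.
    by rewrite !conjgE !ffunE.
  by rewrite memJ_norm.
(* The top group permutes the coordinates, and the condition defining [C] is the same at each of
   them. *)
case/mapP => g _ ->; rewrite inE.
apply/subsetP => _ /imsetP[_ /morphimP[u _ uB ->] ->].
rewrite -sdpair_act ?inE //=; apply: mem_morphim; first by rewrite inE.
by apply/setXnP => i; rewrite ffunE; move/setXnP: uB.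
Qed.

Lemma card_wreath : #|[set: wreath H G]| = (#|H| ^ #|G| * #|G|)%N.
Proof.
rewrite -(sdprod_card (sdprod_sdpair (wr_groupAction H G))).
rewrite !card_injm ?injm_sdpair1 ?injm_sdpair2 // !cardsT.
by rewrite card_dep_ffun foldrE big_map big_enum prod_nat_const.
Qed.

End Wreath.

(** * Towers in both families *)

Lemma wreath_tower_generated (H G : finGroupType) :
  tower_generated H -> tower_generated G -> tower_generated (wreath H G).
Proof.
move=> [sH tow_H genH] [sG tow_G genG]; exists (wr_seq sH sG).
  exact: abelian_tower_wr_seq.
exact: gen_wr_seq.
Qed.

Lemma semiabelian_tower_generated (G : finGroupType) :
  semiabelian G -> tower_generated G.
Proof.
elim=> {G} [T T1|A H to abA _ genH|G Gamma f _ genG epi_f].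
- by apply: abelian_tower_generated; rewrite T1 abelian1.
- exact: sdprod_tower_generated.
- exact: quotient_tower_generated epi_f genG.
Qed.

Lemma in_G_tower_generated p (G : finGroupType) :
  in_G p G -> p.-group [set: G] /\ tower_generated G.
Proof.
elim=> {G} [A abA pA|H G _ [pH genH] _ [pG genG]|G Gamma f _ [pG genG] epi_f _].
- by split; last exact: abelian_tower_generated.
- split; last exact: wreath_tower_generated.
  rewrite /pgroup card_wreath pnatM pnatX; move: pH pG.
  by rewrite /pgroup !cardsT => -> ->.
- split; last exact: quotient_tower_generated epi_f genG.
  by rewrite -epi_f morphim_pgroup.
Qed.

(** * A quotient of the wreath product *)

Section WreathQuotient.

Variables (gT H T : finGroupType).
Variables (e : {morphism [set: H] >-> gT}) (f : {morphism [set: T] >-> gT}).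
Variable A : {group gT}.
Hypotheses (abA : abelian A) (eA : e @* [set: H] \subset A).
Hypothesis fN : f @* [set: T] \subset 'N(A).

Let Ae h : e h \in A.
Proof. by rewrite (subsetP eA) // mem_morphim ?inE. Qed.

Let Nf t : f t \in 'N(A).
Proof. by rewrite (subsetP fN) // mem_morphim ?inE. Qed.

(* The product of the e (b t) ^ f t over all t, written additively in A to make
   it independent of the order of its factors. *)
Definition wr_eval (b : wr_base H T) : gT :=
  fmval (\sum_t actr (fmod abA (e (b t))) (f t))%R.

Lemma wr_evalM : {in [set: wr_base H T] &, {morph wr_eval : b c / b * c}}.
Proof.
move=> b c _ _; rewrite /wr_eval -fmvalA -big_split; congr fmval.
by apply: eq_bigr => t _; rewrite ffunE morphM ?inE // fmodM // actAr.
Qed.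

Canonical wr_eval_morphism := Morphism wr_evalM.

Lemma wr_eval_act :
  {in [set: wr_base H T] & [set: T],
    morph_act (wr_groupAction H T) 'J wr_eval f}.
Proof.
move=> b t _ _; rewrite /= /wr_eval -fmvalJ // actr_sum; congr fmval.
(* Substituting [u * t] for the index cancels the shift by [t^-1] in the action and leaves a factor
   [f t] on the right. *)
rewrite (reindex_inj (mulIg t)); apply: eq_bigr => u _ /=.
by rewrite ffunE mulgK morphM ?inE // actrM.
Qed.

Lemma wr_eval_delta h : wr_eval (wr_delta 1 h) = e h.
Proof.
rewrite /wr_eval (bigD1 1) //= big1 => [|t ne_t1].
  by rewrite /wr_delta dfung1_id morph1 actr1 GRing.addr0 fmodK.
by rewrite /wr_delta dfung1_dflt ?[1 == _]eq_sym // morph1 morph1 act0r.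
Qed.

(** By equivariance [wr_eval] and [f] glue to a morphism on the semidirect product. Its image
    contains that of [e], because [wr_eval] restricts to [e] on the coordinate at 1. *)
Lemma wreath_quotient :
  exists h : {morphism [set: wreath H T] >-> gT},
    h @* [set: wreath H T] = e @* [set: H] <*> f @* [set: T].
Proof.
exists (xsdprod_morphism wr_eval_act); rewrite im_xsdprodm.
apply/eqP; rewrite eqEsubset mul_subG ?joing_subr //=; last first.
  apply/subsetP => _ /morphimP[b _ _ ->]; rewrite /= /wr_eval fmval_sum.
  apply: group_prod => t _; rewrite fmvalJ // fmodK // groupJ //.
    by apply: (subsetP (joing_subl _ _)); rewrite mem_morphim ?inE.
  by apply: (subsetP (joing_subr _ _)); rewrite mem_morphim ?inE.
(* The image is a product of two subgroups. It equals their join once [f] is seen to normalise the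
   image of [wr_eval], which is checked last. *)
rewrite -norm_joinEr.
  rewrite join_subG joing_subr andbT; apply/subsetP => _ /morphimP[h _ _ ->].
  apply: (subsetP (joing_subl _ _)); rewrite -wr_eval_delta.
  by apply: mem_morphim; rewrite inE.
apply/subsetP => _ /morphimP[t _ _ ->]; rewrite inE.
apply/subsetP => _ /imsetP[_ /morphimP[b _ _ ->] ->].
have /= <- := wr_eval_act (in_setT b) (in_setT t).
by apply: mem_morphim; rewrite inE.
Qed.

End WreathQuotient.

(** * The Burnside basis theorem for subsequences *)

(** Greedy choice of a basis from the end of [s]: an entry is kept exactly when its image lies
    outside the span of the later ones. *)
Lemma abelem_subseq (gT rT : finGroupType) (D : {group gT})
    (f : {morphism D >-> rT}) (s : seq gT) p :
    prime p -> [set:: s] \subset D -> p.-abelem (f @* <<[set:: s]>>) ->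
  exists2 t, subseq t s &
    f @* <<[set:: t]>> = f @* <<[set:: s]>> /\
    #|f @* <<[set:: s]>>| = (p ^ size t)%N.
Proof.
move=> p_pr; elim: s => [|x s IHs].
  by exists [::]; rewrite // set_nil gen0 morphim1 cards1.
rewrite set_cons subUset sub1set => /andP[Dx sD].
rewrite -joingE -joing_idr morphimY ?gen_subG ?sub1set // morphim_set1 //.
set K := f @* <<[set:: s]>> => abel_xK.
have sKxK : K \subset [set f x] <*> K := joing_subr _ _.
have [t sub_ts [eq_tK cardK]] := IHs sD (abelemS sKxK abel_xK).
have tD : [set:: t] \subset D.
  apply: subset_trans sD; apply/subsetP => z.
  by rewrite !inE; apply: mem_subseq.
have [Kfx | notKfx] := boolP (f x \in K).
  have ->: [set f x] <*> K = K by apply/joing_idPr; rewrite sub1set.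
  by exists t; first exact: subseq_trans sub_ts (subseq_cons s x).
exists (x :: t); first by rewrite /= eqxx.
rewrite set_cons -joingE -joing_idr morphimY ?gen_subG ?sub1set //.
rewrite morphim_set1 // eq_tK; split=> //.
have xKfx : f x \in [set f x] <*> K by rewrite mem_gen // inE set11.
have cKfx : <[f x]> \subset 'C(K).
  apply: sub_abelian_cent2 (abelem_abelian abel_xK) _ sKxK.
  by rewrite cycle_subG.
have fx1 : f x != 1 by apply: contraNneq notKfx => ->.
have ofx : #[f x] = p := abelem_order_p abel_xK xKfx fx1.
(* The cyclic group of [f x] has prime order and is not contained in [K], so it meets [K] trivially
   and the order grows by a factor [p]. *)
rewrite -joing_idl cent_joinEl // TI_cardMg -/K ?cardK; last first.
  by apply: prime_TIg; rewrite ?cycle_subG // -orderE ofx.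
by rewrite -orderE ofx -expnS.
Qed.

(** A basis of the Frattini quotient is chosen among the images of [s]; the chosen entries generate
    because the Frattini subgroup consists of non-generators. *)
Lemma pgroup_minimal_subseq (gT : finGroupType) p (s : seq gT) :
    prime p -> p.-group <<[set:: s]>> ->
  exists2 t, subseq t s &
    <<[set:: t]>> = <<[set:: s]>> /\ size t <= 'm(<<[set:: s]>>).
Proof.
pose G := <<[set:: s]>>%G; move=> p_pr pG.
have nPhiG : G \subset 'N('Phi(G)) := normal_norm (Phi_normal G).
have sD : [set:: s] \subset 'N('Phi(G)).
  exact: subset_trans (subset_gen _) nPhiG.
have abelG : p.-abelem (G / 'Phi(G)) := Phi_quotient_abelem pG.
have [t sub_ts [eq_t cardG]] := abelem_subseq p_pr sD abelG.
have sub_tG : <<[set:: t]>> \subset G.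
  by apply: genS; apply/subsetP => z; rewrite !inE; apply: mem_subseq.
exists t => //; split.
  rewrite -[RHS]/(gval G); apply: Phi_nongen.
  rewrite -joing_idr -quotientYK ?(subset_trans sub_tG) //.
  by rewrite [_ / _]eq_t quotientGK ?Phi_normal.
(* The length of [t] is the rank of the elementary abelian Frattini quotient, whose number of
   generators is at most that of [G]. *)
apply: leq_trans (quotient_grank nPhiG).
rewrite (grank_abelian (abelem_abelian abelG)) (rank_abelem abelG).
by rewrite cardG pfactorK.
Qed.

Lemma grank_set_seq (gT : finGroupType) (s : seq gT) :
  'm(<<[set:: s]>>) <= size s.
Proof. exact: leq_trans (grank_min _) (card_set_seq s). Qed.

Lemma grank_wreath (H G : finGroupType) :
  'm([set: wreath H G]) <= 'm([set: H]) + 'm([set: G]).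
Proof.
have [BH genH <-] := grank_witness [set: H].
have [BG genG <-] := grank_witness [set: G].
have gen_enum_set (T : finGroupType) (B : {set T}) :
  <<B>> = [set: T] -> <<[set:: enum B]>> = [set: T] by rewrite set_enum.
rewrite -(gen_wr_seq (gen_enum_set _ _ genH) (gen_enum_set _ _ genG)).
by apply: leq_trans (grank_set_seq _) _; rewrite size_cat !size_map -!cardE.
Qed.

(** * Iterated wreath products and equality of the families *)

Lemma iterated_wreath (gT : finGroupType) (s : seq gT) :
    abelian_tower s ->
  exists W : finGroupType, exists f : {morphism [set: W] >-> gT},
    [/\ f @* [set: W] = <<[set:: s]>>, 'm([set: W]) <= size s, semiabelian W
      & forall p : nat, p.-group <<[set:: s]>> -> in_G p W].
Proof.
elim: s => [_|x s IHs /= /andP[abx /IHs[W [f [im_f rankW sabW inGW]]]]].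
  exists (subg_of 1%G), (sgval_morphism 1%G : {morphism [set: _] >-> gT}).
  have T1 : [set: subg_of (1%G : {group gT})] = 1.
    by rewrite -im_subg morphim1.
  rewrite set_nil gen0 im_sgval T1.
  split=> // [||p _].
  - by rewrite -gen0 (leq_trans (grank_min _)) ?cards0.
  - exact: semiabelian_trivial.
  - by apply: in_G_abelian; rewrite T1 ?abelian1 ?pgroup1.
pose H : finGroupType := subg_of <[x]>%G.
have genH : <<[set:: [:: subg <[x]> x]]>> = [set: H].
  rewrite set_cons set_nil setU0 -im_subg morphim_gen ?sub1set ?cycle_id //.
  by rewrite morphim_set1 ?cycle_id.
have abH : abelian [set: H] by rewrite -im_subg morphim_abelian ?cycle_abelian.
(* The tower condition at [x] is exactly what makes [A] abelian, so that [wreath_quotient] maps the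
   wreath product of the cyclic group of [x] by [W] onto the group generated by [x] and [s]. *)
pose A := <<x ^: <<[set:: s]>>>>%G.
have abA : abelian A by rewrite abelian_gen.
pose e := (sgval_morphism <[x]>%G : {morphism [set: H] >-> gT}).
have im_e : e @* [set: H] = <[x]> by exact: im_sgval.
have eA : e @* [set: H] \subset A.
  by rewrite im_e cycle_subG mem_gen // class_refl.
have fN : f @* [set: W] \subset 'N(A).
  by rewrite im_f norms_gen // class_norm.
have [h im_h] := wreath_quotient abA eA fN.
exists (wreath H W), h; split.
- by rewrite im_h im_e im_f set_cons joing_idl joing_idr.
- apply: leq_trans (grank_wreath _ _) _; rewrite -add1n leq_add //.
  by rewrite -genH grank_set_seq.
- apply: semiabelian_sdprod sabW; apply/centsP => b _ c _.
  by apply/ffunP => t; rewrite !ffunE; apply: (centsP abH); rewrite inE.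
move=> p pxs; apply: in_G_wreath.
  apply: in_G_abelian abH _.
  rewrite -im_subg morphim_pgroup // (pgroupS _ pxs) //.
  by rewrite cycle_subG mem_gen // set_cons setU11.
apply: inGW; apply: pgroupS pxs; apply: genS.
by rewrite set_cons subsetUr.
Qed.

Theorem corollary4p6 (p : nat) (hp : prime p) (G : finGroupType) :
  in_G p G <-> in_S p G.
Proof.
split=> [/in_G_tower_generated[pG [s tow_s gen_s]] | [pG sabG]].
  split=> //; have [W [f [im_f _ sabW _]]] := iterated_wreath tow_s.
  by apply: (@semiabelian_quotient W G f sabW); rewrite /epimorphism im_f.
have [s tow_s gen_s] := semiabelian_tower_generated sabG.
have [|t sub_ts [gen_t size_t]] := @pgroup_minimal_subseq G p s hp.
  by rewrite gen_s.
have tow_t := abelian_tower_subseq sub_ts tow_s.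
have [W [f [im_f rankW _ inGW]]] := iterated_wreath tow_t.
have epi_f : epimorphism f by rewrite /epimorphism im_f gen_t gen_s.
apply: (@in_G_quotient p W G f) => //.
  by apply: inGW; rewrite gen_t gen_s.
(* The rank of [W] is at most the length of [t], hence at most the rank of [G]; the converse bound
   holds for any quotient. *)
apply/eqP; rewrite eqn_leq (leq_trans rankW) /=; last by rewrite -gen_s.
by rewrite -epi_f morphim_grank.
Qed.
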